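(* Let $K$ be a closed subset of $G$. Then for any $f\in\mathcal{L}(\mathcal{X}_K)$, any $x_{P(K)}\in\mathcal{X}_{P(K)}$, any $h\in\mathcal{L}(\mathcal{X}_{N(K)})$ and any non-negative $g\in\mathcal{L}(\mathcal{X}_{N'(K)})$: $$\underline{E}^{\mathrm{irr}}_G\Big(h(X_{N(K)})+g(X_{N'(K)})\,\mathbb{I}_{x_{P(K)}}(X_{P(K)})\,f(X_K)\Big)=\underline{E}^{\mathrm{irr}}_{N(K)}\Big(h(X_{N(K)})+g(X_{N'(K)})\,\mathbb{I}_{x_{P(K)}}(X_{P(K)})\,\underline{E}^{\mathrm{irr}}_{K\mid x_{P(K)}}\big(f(X_K)\big)\Big).$$
   Context: Setting: $G$ is a finite set of nodes forming a DAG; node $s$ carries a variable $X_s$ with finite nonempty state space $\mathcal{X}_s$; $\mathcal{X}_S=\times_{s\in S}\mathcal{X}_s$; $\mathcal{L}(\mathcal{X}_S)$ is the set of real-valued functions on $\mathcal{X}_S$. $\mathbb{I}_{x_{P(K)}}$ is the indicator of $\{x_{P(K)}\}$. $P(s)$: parents; $s\sqsubseteq v$: directed path (possibly trivial) from $s$ to $v$; $s\sqsubset v$: additionally $s\neq v$; $D(s)=\{v:s\sqsubset v\}$; $N(s)=G\setminus(\{s\}\cup D(s))$. For $K\subseteq G$: $P(K)=(\bigcup_{s\in K}P(s))\setminus K$, $D(K)=(\bigcup_{s\in K}D(s))\setminus K$, $N(K)=G\setminus(K\cup D(K))$, $N'(K)=N(K)\setminus P(K)$; $K$ is closed if $s\sqsubseteq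 k\sqsubseteq t$ with $s,t\in K$ implies $k\in K$. Local models: nonempty closed convex sets $\mathcal{M}_{s\mid x_{P(s)}}$ of probability mass functions on $\mathcal{X}_s$. Full conditional probability measure on finite $\Omega$: $(A,B)\mapsto P(A\mid B)$ ($B\ne\emptyset$), (F1) $P(\cdot\mid B)$ a probability measure with $P(B\mid B)=1$, (F2) $P(A\cap C\mid B)=P(A\mid C\cap B)P(C\mid B)$ if $C\cap B\neq\emptyset$. Irrelevant natural extension $\mathcal{F}^{\mathrm{irr}}_G$: all full conditional probability measures $P$ on $\mathcal{X}_G$ with $P(X_s\mid x_{N(s)})\in\mathcal{M}_{s\mid x_{P(s)}}$ for all $s, x_{N(s)}$. $\underline{E}^{\mathrm{irr}}_G(f(X_G))=\inf\{\sum_{z_G}f(z_G)P(z_G):P\in\mathcal{F}^{\mathrm{irr}}_G\}$. Sub-network: for $K\subseteq G$ and fixed $x_{P(K)}$, the credal network on the DAG restricted to $K$ with local credal sets $\mathcal{M}_{s\mid(z_{P(s)\cap K},x_{P(s)\setminus K})}$; its irrelevant-natural-extension lower expectation is $\underline{E}^{\mathrm{irr}}_{K\mid x_{P(K)}}$, written $\underline{E}^{\mathrm{irr}}_K$ when $P(K)=\emptyset$ (in particular $\underline{E}^{\mathrm{irr}}_{N(K)}$, since $N(K)$ has no parents outside itself). Upper expectations: $\overline{E}(f)=-\underline{E}(-f)$. *)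

(* Defs.v *)
From mathcomp Require Import all_boot.
From Stdlib Require Import Reals ClassicalEpsilon.
Set Warnings "-notation-overridden".


Local Open Scope R_scope.

Definition Rsum (T : finType) (F : T -> R) : R := \big[Rplus/0%R]_(t : T) F t.
Arguments Rsum {T} F.

Definition is_glb (S : R -> Prop) (m : R) : Prop :=
  (forall y, S y -> m <= y) /\ (forall w, (forall y, S y -> w <= y) -> w <= m).

(* infimum of a set of reals (meaningful when the set is nonempty and
   bounded below, which is the case for lower expectations below) *)
Definition Rinf (S : R -> Prop) : R := epsilon (inhabits 0%R) (is_glb S).

Definition cfg (I : finType) (X : I -> finType) : finType :=
  {dffun forall i : I, X i}.
Arguments cfg {I} X.

Definition sub (I : finType) (K : {set I}) : finType := {i : I | i \in K}.
Arguments sub {I} K.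

Definition Xsub (I : finType) (X : I -> finType) (K : {set I}) : sub K -> finType :=
  fun a => X (val a).
Arguments Xsub {I} X K.

Definition restr (I : finType) (X : I -> finType) (K : {set I}) (z : cfg X)
  : cfg (Xsub X K) := finfun (fun a : sub K => z (val a)).
Arguments restr {I X} K z.

Definition glue (I : finType) (X : I -> finType) (K : {set I})
  (zK : cfg (Xsub X K)) (x : cfg X) : cfg X :=
  finfun (fun s : I =>
    match boolP (s \in K) with
    | AltTrue h => zK (exist (fun i => i \in K) s h)
    | AltFalse _ => x s
    end).
Arguments glue {I X K} zK x.

Definition parents (I : finType) (par : rel I) (s : I) : {set I} := [set u | par u s].
Arguments parents {I} par s.
Definition desc (I : finType) (par : rel I) (s : I) : {set I} :=
  [set v | (v != s) && connect par s v].
Arguments desc {I} par s.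
Definition nondesc (I : finType) (par : rel I) (s : I) : {set I} :=
  ~: (s |: desc par s).
Arguments nondesc {I} par s.

Definition acyclic (I : finType) (par : rel I) : Prop :=
  forall u v, par u v -> ~~ connect par v u.
Arguments acyclic {I} par.

Definition parK (I : finType) (par : rel I) (K : {set I}) : {set I} :=
  (\bigcup_(s in K) parents par s) :\: K.
Arguments parK {I} par K.
Definition descK (I : finType) (par : rel I) (K : {set I}) : {set I} :=
  (\bigcup_(s in K) desc par s) :\: K.
Arguments descK {I} par K.
Definition ndK (I : finType) (par : rel I) (K : {set I}) : {set I} :=
  ~: (K :|: descK par K).
Arguments ndK {I} par K.
Definition nd'K (I : finType) (par : rel I) (K : {set I}) : {set I} :=
  ndK par K :\: parK par K.
Arguments nd'K {I} par K.

Definition closedK (I : finType) (par : rel I) (K : {set I}) : Prop :=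
  forall s k t, s \in K -> t \in K -> connect par s k -> connect par k t -> k \in K.
Arguments closedK {I} par K.

Definition is_pmf (T : finType) (p : T -> R) : Prop :=
  (forall t, 0 <= p t) /\ Rsum p = 1.
Arguments is_pmf {T} p.

(* M s x : the local credal set M_{s | x_{P(s)}}, indexed by a joint
   configuration x but required to depend on x only through x_{P(s)}. *)
Definition local_models (I : finType) (par : rel I) (X : I -> finType)
  (M : forall s : I, cfg X -> (X s -> R) -> Prop) : Prop :=
  forall s : I,
    (forall x y : cfg X, (forall u, par u s -> x u = y u) ->
        forall p, M s x p <-> M s y p) /\
    (forall x, exists p, M s x p) /\
    (forall x p, M s x p -> is_pmf p) /\
    (forall x p q l, M s x p -> M s x q -> 0 <= l <= 1 ->
        M s x (fun a => l * p a + (1 - l) * q a)) /\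
    (forall x (pn : nat -> X s -> R) p, (forall n, M s x (pn n)) ->
        (forall a, Un_cv (fun n => pn n a) (p a)) -> M s x p).
Arguments local_models {I} par {X} M.

Definition fcpm (Om : finType) (P : {set Om} -> {set Om} -> R) : Prop :=
  (forall A B : {set Om}, B != set0 -> 0 <= P A B) /\
  (forall B : {set Om}, B != set0 -> P [set: Om] B = 1) /\
  (forall A A' B : {set Om}, B != set0 -> [disjoint A & A'] ->
      P (A :|: A') B = P A B + P A' B) /\
  (forall B : {set Om}, B != set0 -> P B B = 1) /\
  (forall A B C : {set Om}, C :&: B != set0 -> P (A :&: C) B = P A (C :&: B) * P C B).
Arguments fcpm {Om} P.

Definition ev_node (I : finType) (X : I -> finType) (s : I) (a : X s)
  : {set cfg X} := [set z : cfg X | z s == a].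
Arguments ev_node {I X s} a.
Definition ev_eq (I : finType) (X : I -> finType) (S : {set I}) (x : cfg X)
  : {set cfg X} := [set z : cfg X | [forall i in S, z i == x i]].
Arguments ev_eq {I X} S x.

Definition irr_ext (I : finType) (par : rel I) (X : I -> finType)
  (M : forall s : I, cfg X -> (X s -> R) -> Prop)
  (P : {set cfg X} -> {set cfg X} -> R) : Prop :=
  fcpm P /\
  forall (s : I) (x : cfg X),
    M s x (fun a : X s => P (ev_node a) (ev_eq (nondesc par s) x)).
Arguments irr_ext {I} par {X} M P.

Definition lowE (I : finType) (par : rel I) (X : I -> finType)
  (M : forall s : I, cfg X -> (X s -> R) -> Prop) (f : cfg X -> R) : R :=
  Rinf (fun v => exists P, irr_ext par M P /\
          v = Rsum (fun z : cfg X => f z * P [set z] [set: cfg X])).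
Arguments lowE {I} par {X} M f.

Definition par_sub (I : finType) (par : rel I) (K : {set I}) : rel (sub K) :=
  fun a b => par (val a) (val b).
Arguments par_sub {I} par K.

(* local models of the sub-network on K, with the values x_{P(K)} taken from
   the joint configuration x (only its P(K)-coordinates matter) *)
Definition M_sub (I : finType) (X : I -> finType)
  (M : forall s : I, cfg X -> (X s -> R) -> Prop) (K : {set I}) (x : cfg X)
  : forall a : sub K, cfg (Xsub X K) -> (Xsub X K a -> R) -> Prop :=
  fun a z => M (val a) (glue z x).
Arguments M_sub {I X} M K x a z _.

Definition lowE_sub (I : finType) (par : rel I) (X : I -> finType)
  (M : forall s : I, cfg X -> (X s -> R) -> Prop) (K : {set I}) (x : cfg X)
  (f : cfg (Xsub X K) -> R) : R :=
  lowE (par_sub par K) (M_sub M K x) f.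
Arguments lowE_sub {I} par {X} M K x f.

Definition indR (b : bool) : R := if b then 1 else 0.

(* Main.v *)
Require Import Defs.
From HB Require Import structures.
From Stdlib Require Import Reals Lra ClassicalEpsilon FunctionalExtensionality.
From mathcomp Require Import all_boot.
Set Implicit Arguments.
Unset Strict Implicit.
Unset Printing Implicit Defensive.
Local Open Scope R_scope.

(* For >=: if P is in the extension of G, then its marginal on N(K) and its
   conditionals on K given x_{N(K)} are in the extensions of the sub-networks.

   For <=: let P1 and P2 be in the extensions of the sub-networks N(K) and K.
   Null conditioning events may be ignored: a mass function p on X_G extends to
   an element of the extension of G as soon as p(X_s | x_{N(s)}) is in the local
   model whenever p(x_{N(s)}) > 0. To define p, draw y from the product of P1 and
   P2 and generate z along the DAG: copy y_t if t is in N(K), or if t is in K and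
   z agrees with the prescribed x_{P(K)} at all ancestors of t in P(K); otherwise
   draw z_t from a fixed selection of the local models. Thus P2 is used where
   z_{P(K)} = x_{P(K)}, and a node s of N(K) influences z_t only if t is in D(s),
   so that X_s remains independent of its nondescendants in K. *)

(** * Finite sums and masses *)

Lemma Rplus_associative : associative Rplus.
Proof. by move=> a b c; ring. Qed.
Lemma Rplus_commutative : commutative Rplus.
Proof. by move=> a b; ring. Qed.
Lemma Rmult_associative : associative Rmult.
Proof. by move=> a b c; ring. Qed.
Lemma Rmult_commutative : commutative Rmult.
Proof. by move=> a b; ring. Qed.
Lemma Rmult_left_distributive : left_distributive Rmult Rplus.
Proof. by move=> a b c; ring. Qed.
Lemma Rmult_right_distributive : right_distributive Rmult Rplus.
Proof. by move=> a b c; ring. Qed.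

HB.instance Definition _ :=
  Monoid.isComLaw.Build R 0 Rplus Rplus_associative Rplus_commutative Rplus_0_l.
HB.instance Definition _ :=
  Monoid.isComLaw.Build R 1 Rmult Rmult_associative Rmult_commutative Rmult_1_l.
HB.instance Definition _ := Monoid.isMulLaw.Build R 0 Rmult Rmult_0_l Rmult_0_r.
HB.instance Definition _ :=
  Monoid.isAddLaw.Build R Rmult Rplus Rmult_left_distributive Rmult_right_distributive.

Lemma eq_Rsum (T : finType) (F G : T -> R) : (forall t, F t = G t) -> Rsum F = Rsum G.
Proof. by move=> e; apply: eq_bigr => t _; exact: e. Qed.

Lemma RsumD (T : finType) (F G : T -> R) :
  Rsum (fun t => F t + G t) = Rsum F + Rsum G.
Proof. exact: big_split. Qed.

Lemma mulRsum (T : finType) (c : R) (F : T -> R) :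
  c * Rsum F = Rsum (fun t => c * F t).
Proof. exact: big_distrr. Qed.

Lemma exchange_Rsum (S T : finType) (F : S -> T -> R) :
  Rsum (fun s => Rsum (F s)) = Rsum (fun t => Rsum (F^~ t)).
Proof. exact: exchange_big. Qed.

Lemma Rsum_const0 (T : finType) (F : T -> R) : (forall t, F t = 0) -> Rsum F = 0.
Proof. by move=> e; apply: big1 => t _; exact: e. Qed.

Lemma Rsum_ge0 (T : finType) (F : T -> R) : (forall t, 0 <= F t) -> 0 <= Rsum F.
Proof.
move=> h; apply: (big_ind (fun y => 0 <= y)) => //; first by lra.
by move=> a b; lra.
Qed.

Lemma Rsum_opp (T : finType) (F : T -> R) : Rsum (fun t => - F t) = - Rsum F.
Proof.
rewrite (_ : - Rsum F = -1 * Rsum F); last by ring.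
by rewrite mulRsum; apply: eq_Rsum => t; ring.
Qed.

Lemma Rsum_le (T : finType) (F G : T -> R) :
  (forall t, F t <= G t) -> Rsum F <= Rsum G.
Proof.
move=> h; have := @Rsum_ge0 T (fun t => G t + - F t).
rewrite RsumD Rsum_opp => H; suff: 0 <= Rsum G + - Rsum F by lra.
by apply: H => t; have := h t; lra.
Qed.

Lemma Rsum_pick (T : finType) (t0 : T) (F : T -> R) :
  (forall t, t != t0 -> F t = 0) -> Rsum F = F t0.
Proof.
move=> h; rewrite /Rsum (bigD1 t0) //= big1 ?Rplus_0_r // => t; exact: h.
Qed.

Lemma Rsum_ge_term (T : finType) (t0 : T) (F : T -> R) :
  (forall t, 0 <= F t) -> F t0 <= Rsum F.
Proof.
move=> h; rewrite /Rsum (bigD1 t0) //=.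
suff: 0 <= \big[Rplus/0]_(i | i != t0) F i by lra.
apply: (big_ind (fun y => 0 <= y)) => //; first by lra.
by move=> a b; lra.
Qed.

Lemma Rsum_prod (S T : finType) (F : S -> R) (G : T -> R) :
  Rsum (fun u : S * T => F u.1 * G u.2) = Rsum F * Rsum G.
Proof.
rewrite {2}/Rsum big_distrl /=.
under [RHS]eq_bigr => s _ do rewrite big_distrr /=.
by rewrite pair_big.
Qed.

Lemma indR_ge0 b : 0 <= indR b.
Proof. by case: b => /=; lra. Qed.

Lemma indRM a b : indR (a && b) = indR a * indR b.
Proof. by case: a; case: b => /=; ring. Qed.

Lemma prod_indR (T : finType) (A Q : pred T) :
  \big[Rmult/1]_(t | A t) indR (Q t) = indR [forall (t | A t), Q t].
Proof.
case: (boolP [forall (t | A t), Q t]) => [/forall_inP h | /forall_inPn[t At nQ]].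
  by rewrite big1 // => t At; rewrite h.
by rewrite (bigD1 t) //= (negbTE nQ) /= Rmult_0_l.
Qed.

Lemma prodR_ge0 (T : finType) (A : pred T) (F : T -> R) :
  (forall t, 0 <= F t) -> 0 <= \big[Rmult/1]_(t | A t) F t.
Proof.
move=> h; apply: (big_ind (fun y => 0 <= y)) => //; first by lra.
exact: Rmult_le_pos.
Qed.

Definition mass (T : finType) (p : T -> R) (A : {set T}) : R :=
  Rsum (fun z => indR (z \in A) * p z).

Lemma mass_ge0 (T : finType) (p : T -> R) A : (forall z, 0 <= p z) -> 0 <= mass p A.
Proof. by move=> h; apply: Rsum_ge0 => z; apply: Rmult_le_pos; [exact: indR_ge0 | exact: h]. Qed.

Lemma mass_setT (T : finType) (p : T -> R) : mass p [set: T] = Rsum p.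
Proof. by apply: eq_Rsum => z; rewrite inE /=; ring. Qed.

Lemma mass_set1 (T : finType) (p : T -> R) z : mass p [set z] = p z.
Proof.
rewrite /mass (@Rsum_pick _ z); first by rewrite inE eqxx /=; ring.
by move=> t /negbTE nt; rewrite inE nt /=; ring.
Qed.

Lemma mass_le (T : finType) (p : T -> R) (A B : {set T}) :
  (forall z, 0 <= p z) -> A \subset B -> mass p A <= mass p B.
Proof.
move=> h /subsetP sAB; apply: Rsum_le => z; apply: Rmult_le_compat_r; first exact: h.
case: (boolP (z \in A)) => [/sAB -> | _] /=; [lra | exact: indR_ge0].
Qed.

Lemma mass_setU (T : finType) (p : T -> R) (A B : {set T}) :
  [disjoint A & B] -> mass p (A :|: B) = mass p A + mass p B.
Proof.
move=> dAB; rewrite -RsumD; apply: eq_Rsum => z; rewrite inE.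
case: (boolP (z \in A)) => [zA | _] /=; last by ring.
by rewrite (disjointFr dAB zA) /=; ring.
Qed.

(** * Full conditional measures *)

Section FullConditional.
Variables (T : finType) (P : {set T} -> {set T} -> R).
Hypothesis fP : fcpm P.

Lemma fcpm_ge0 (A B : {set T}) : B != set0 -> 0 <= P A B.
Proof. by case: fP => h _; exact: h. Qed.

Lemma fcpm_cap (A B C : {set T}) : C :&: B != set0 -> P (A :&: C) B = P A (C :&: B) * P C B.
Proof. by case: fP => _ [_ [_ [_ h]]]; exact: h. Qed.

Lemma fcpm_self (B : {set T}) : B != set0 -> P B B = 1.
Proof. by case: fP => _ [_ [_ [h _]]]; exact: h. Qed.

Lemma fcpm_setT (B : {set T}) : B != set0 -> P setT B = 1.
Proof. by case: fP => _ [h _]; exact: h. Qed.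

Lemma fcpm_setU (A A' B : {set T}) : B != set0 -> [disjoint A & A'] ->
  P (A :|: A') B = P A B + P A' B.
Proof. by case: fP => _ [_ [h _]]; exact: h. Qed.

Lemma fcpm_set0 (B : {set T}) : B != set0 -> P set0 B = 0.
Proof.
move=> B0; have d00 : [disjoint (set0 : {set T}) & set0] by rewrite -setI_eq0 setI0.
by have := fcpm_setU B0 d00; rewrite setU0; lra.
Qed.

Lemma fcpm_capr (A B : {set T}) : B != set0 -> P (A :&: B) B = P A B.
Proof.
by move=> B0; rewrite fcpm_cap ?setIid // fcpm_self //; ring.
Qed.

Lemma fcpm_mass (A B : {set T}) : B != set0 -> P A B = mass (fun z => P [set z] B) A.
Proof.
move=> B0; have [n] := ubnP #|A|; elim: n A => // n IH A lA.
case: (set_0Vmem A) => [-> | [z zA]].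
  by rewrite fcpm_set0 // /mass Rsum_const0 // => z; rewrite inE /=; ring.
rewrite -(setD1K zA); have dz : [disjoint [set z] & A :\ z].
  by rewrite disjoints1 !inE eqxx.
rewrite fcpm_setU // mass_setU // mass_set1 -IH //.
by rewrite (cardsD1 z) zA in lA.
Qed.

Lemma fcpm_subset (A B : {set T}) : B != set0 -> B \subset A -> P A B = 1.
Proof. by move=> B0 /setIidPr sBA; rewrite -fcpm_capr // sBA fcpm_self. Qed.

Lemma fcpm_set1_notin z (B : {set T}) : B != set0 -> z \notin B -> P [set z] B = 0.
Proof.
move=> B0 zB; rewrite -fcpm_capr // (_ : _ :&: _ = set0) ?fcpm_set0 //.
by apply/disjoint_setI0; rewrite disjoints1.
Qed.

Lemma fcpm_Rsum (B : {set T}) : B != set0 -> Rsum (fun z => P [set z] B) = 1.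
Proof. by move=> B0; rewrite -mass_setT -fcpm_mass // fcpm_setT. Qed.

End FullConditional.

(** This is the image under [u] of [P] conditioned on [N]. Since [u] maps [N] onto [T'], the
    preimage of a nonempty event meets [N], so conditioning events stay nonempty. *)
Lemma fcpm_preim (T T' : finType) (P : {set T} -> {set T} -> R) (u : T -> T') (N : {set T}) :
  fcpm P -> (forall t', exists2 t, t \in N & u t = t') ->
  fcpm (fun A B : {set T'} => P (u @^-1: A) (u @^-1: B :&: N)).
Proof.
move=> fP surj.
have nz (B : {set T'}) : B != set0 -> u @^-1: B :&: N != set0.
  case/set0Pn => t' tB; have [t tN et] := surj t'.
  by apply/set0Pn; exists t; rewrite !inE et tB.
split=> [A B /nz B0|]; first exact: fcpm_ge0.
split=> [B /nz B0|]; first by rewrite preimsetT fcpm_setT.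
split=> [A A' B /nz B0 dA|].
  rewrite preimsetU fcpm_setU //; rewrite -setI_eq0 -preimsetI.
  by rewrite (disjoint_setI0 dA) preimset0.
split=> [B /nz B0|A B C /nz]; first by rewrite fcpm_subset ?subsetIl.
by rewrite !preimsetI -setIA => CB0; rewrite fcpm_cap.
Qed.

(* Conditioning on the first layer that charges the conditioning event turns
   a lexicographic sequence of mass functions into a full conditional measure. *)
Lemma fcpm_layers (T : finType) (L : nat -> T -> R) :
  (forall n z, 0 <= L n z) -> (forall z, exists n, 0 < L n z) ->
  exists2 P, fcpm P & forall B : {set T}, B != set0 ->
    exists n, [/\ 0 < mass (L n) B, forall m, (m < n)%N -> mass (L m) B = 0 &
      forall A, P A B = mass (L n) (A :&: B) / mass (L n) B].
Proof.
move=> L0 Lpos.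
pose first (B : {set T}) n := 0 < mass (L n) B /\ forall m, (m < n)%N -> mass (L m) B = 0.
have firstE B n m : first B n -> first B m -> n = m.
  move=> [n1 n2] [m1 m2]; case: (ltngtP n m) => // [/m2|/n2] e; lra.
have firstP (B : {set T}) : B != set0 -> exists n, first B n.
  case/set0Pn => z zB; have [n Ln] := Lpos z.
  have : 0 < mass (L n) B.
    apply: (Rlt_le_trans _ _ _ Ln); rewrite -[L n z]mass_set1.
    by apply: mass_le => //; rewrite sub1set.
  elim/ltn_ind: n {Ln} => n IH pn.
  case: (classic (exists m, (m < n)%N /\ 0 < mass (L m) B)) => [[m [mn pm]]|nex].
    exact: (IH m).
  exists n; split => // m mn.
  have := mass_ge0 B (L0 m); case: (Rtotal_order 0 (mass (L m) B)) => [pm|]; last by lra.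
  by case: nex; exists m.
pose fst_ B := epsilon (inhabits 0%N) (first B).
have fstP B : B != set0 -> first B (fst_ B).
  by move=> /firstP h; exact: epsilon_spec.
exists (fun A B => mass (L (fst_ B)) (A :&: B) / mass (L (fst_ B)) B); last first.
  by move=> B /fstP[p1 p2]; exists (fst_ B).
split=> [A B /fstP[p1 _]|].
  by apply: Rmult_le_pos; [exact: mass_ge0 | left; exact: Rinv_0_lt_compat].
split=> [B /fstP[p1 _]|]; first by rewrite setTI; field; lra.
split=> [A A' B /fstP[p1 _] dA|].
  rewrite setIUl mass_setU; first by field; lra.
  by apply: (disjointWl (subsetIl _ _)); apply: (disjointWr (subsetIl _ _)).
split=> [B /fstP[p1 _]|A B C CB0]; first by rewrite setIid; field; lra.
have B0 : B != set0.
  by apply: contraNneq CB0 => ->; rewrite setI0.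
have [p1 p2] := fstP _ B0; have [q1 q2] := fstP _ CB0.
rewrite -setIA; set n := fst_ B in p1 p2 *; set m := fst_ (C :&: B) in q1 q2 *.
(* If layer [n] charges [C :&: B], it is the first to do so, as earlier layers do not even charge
   [B]; otherwise both sides of the product rule are 0. *)
case: (Rtotal_order 0 (mass (L n) (C :&: B))) => [pn|].
  have -> : m = n; last by field; lra.
  apply: (@firstE (C :&: B)); split=> // k kn.
  have := mass_ge0 (C :&: B) (L0 k); have := mass_le (L0 k) (subsetIr C B).
  by rewrite p2 //; lra.
have := mass_ge0 (C :&: B) (L0 n); have := mass_ge0 (A :&: (C :&: B)) (L0 n).
have := mass_le (L0 n) (subsetIr A (C :&: B)) => h1 h2 h3 h4.
have -> : mass (L n) (A :&: (C :&: B)) = 0 by lra.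
have -> : mass (L n) (C :&: B) = 0 by lra.
by rewrite /Rdiv; ring.
Qed.

(** * Configurations and acyclic graphs *)

Section Configurations.
Variables (I : finType) (X : I -> finType).
Implicit Types (z x y : cfg X) (K S : {set I}).

Definition upd z (t : I) (a : X t) : cfg X := finfun (dfwith (fun u => z u) a).

Lemma upd_same z t (a : X t) : upd z a t = a.
Proof. by rewrite ffunE dfwith_in. Qed.

Lemma upd_other z t (a : X t) u : u != t -> upd z a u = z u.
Proof. by move=> ut; rewrite ffunE dfwith_out // eq_sym. Qed.

Lemma upd_upd z t (a b : X t) : upd (upd z a) b = upd z b.
Proof.
apply/ffunP => u; have [->|ut] := eqVneq u t; first by rewrite !upd_same.
by rewrite !upd_other.
Qed.

Lemma upd_id z t : upd z (z t) = z.
Proof.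
apply/ffunP => u; have [->|ut] := eqVneq u t; first by rewrite upd_same.
by rewrite upd_other.
Qed.

Lemma restrE K z (a : Defs.sub K) : restr K z a = z (val a).
Proof. by rewrite ffunE. Qed.

Lemma glue_in K (w : cfg (Xsub X K)) z (a : Defs.sub K) : glue w z (val a) = w a.
Proof.
case: a => s sK; rewrite ffunE /=; case: {-}_ / boolP => [h|]; last by rewrite sK.
by rewrite (bool_irrelevance h sK).
Qed.

Lemma glue_out K (w : cfg (Xsub X K)) z s : s \notin K -> glue w z s = z s.
Proof. by move=> sK; rewrite ffunE; case: {-}_ / boolP => // h; rewrite h in sK. Qed.

Lemma restr_glue K (w : cfg (Xsub X K)) z : restr K (glue w z) = w.
Proof. by apply/ffunP => a; rewrite restrE glue_in. Qed.

Lemma glue_restr K z y s : s \in K -> glue (restr K z) y s = z s.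
Proof.
move=> sK; have := glue_in (restr K z) y (exist _ s sK).
by rewrite restrE.
Qed.

Lemma eq_restr K z y : (forall s, s \in K -> z s = y s) -> restr K z = restr K y.
Proof. by move=> e; apply/ffunP => a; rewrite !restrE e // (valP a). Qed.

Lemma restr_eqP K z y :
  reflect (forall s, s \in K -> z s = y s) (restr K z == restr K y).
Proof.
apply: (iffP eqP) => [e s sK|]; last exact: eq_restr.
by rewrite -(glue_restr z z sK) -(glue_restr y z sK) e.
Qed.

Lemma in_ev_eqP S z y : reflect (forall s, s \in S -> z s = y s) (z \in ev_eq S y).
Proof. by rewrite inE; apply: (iffP forall_inP) => h s /h /eqP. Qed.

Lemma ev_eq_refl S z : z \in ev_eq S z.
Proof. exact/in_ev_eqP. Qed.

Lemma ev_eq_neq0 S z : ev_eq S z != set0.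
Proof. by apply/set0Pn; exists z; exact: ev_eq_refl. Qed.

Lemma ev_eq_sym S z y : (z \in ev_eq S y) = (y \in ev_eq S z).
Proof. by apply/in_ev_eqP/in_ev_eqP => h s /h. Qed.

Lemma eq_ev_eq S z y : (forall s, s \in S -> z s = y s) -> ev_eq S z = ev_eq S y.
Proof.
move=> e; apply/setP => u; apply/in_ev_eqP/in_ev_eqP => h s sS; first by rewrite h ?e.
by rewrite h // e.
Qed.

Lemma sub_ev_eq S S' z : S \subset S' -> ev_eq S' z \subset ev_eq S z.
Proof.
move/subsetP => sS; apply/subsetP => y /in_ev_eqP h.
by apply/in_ev_eqP => s /sS; exact: h.
Qed.

(** Inserting a total mass 1 writes each side as a sum over pairs [(z, a)]; the involution that
    swaps [z t] with [a] fixes [psi] and exchanges the roles of [r] and [r']. *)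
Lemma sum_switch t (psi r r' : cfg X -> R) :
  (forall z (a : X t), psi (upd z a) = psi z) ->
  (forall z, Rsum (fun a : X t => r (upd z a)) = 1) ->
  (forall z, Rsum (fun a : X t => r' (upd z a)) = 1) ->
  Rsum (fun z => psi z * r z) = Rsum (fun z => psi z * r' z).
Proof.
move=> hpsi hr hr'.
transitivity (Rsum (fun za : cfg X * X t => psi za.1 * r za.1 * r' (upd za.1 za.2))).
  rewrite /Rsum -(pair_big xpredT xpredT (fun z (a : X t) => psi z * r z * r' (upd z a))) /=.
  apply: eq_bigr => z _; rewrite -big_distrr /=.
  by move: (hr' z); rewrite /Rsum => ->; ring.
transitivity (Rsum (fun za : cfg X * X t => psi za.1 * r' za.1 * r (upd za.1 za.2))).
  rewrite /Rsum (reindex_onto (fun za : cfg X * X t => (upd za.1 za.2, za.1 t))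
    (fun za : cfg X * X t => (upd za.1 za.2, za.1 t))) /=; last first.
    by move=> [z a] _ /=; rewrite upd_upd upd_id upd_same.
  apply: eq_big => [[z a] /=|[z a] _ /=]; first by rewrite upd_upd upd_id upd_same eqxx.
  by rewrite upd_upd upd_id hpsi; ring.
rewrite /Rsum -(pair_big xpredT xpredT (fun z (a : X t) => psi z * r' z * r (upd z a))) /=.
apply: eq_bigr => z _; rewrite -big_distrr /=.
by move: (hr z); rewrite /Rsum => ->; ring.
Qed.

End Configurations.

Section Graph.
Variables (I : finType) (par : rel I).
Hypothesis dag : acyclic par.

Lemma connect_antisym u v : connect par u v -> connect par v u -> u = v.
Proof.
case/connectP => [[|w p]] /= => [_ -> //|/andP[uw wp] ev] vu.
have wv : connect par w v by apply/connectP; exists p.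
by have := dag uw; rewrite (connect_trans wv vu).
Qed.

Lemma par_neq u v : par u v -> u != v.
Proof. by move=> uv; apply: contraL (uv) => /eqP ->; apply/negP => /dag; rewrite connect0. Qed.

Lemma nondescE s t : (t \in nondesc par s) = ~~ connect par s t.
Proof.
rewrite !inE; have [->|//] := eqVneq t s; by rewrite connect0.
Qed.

Lemma nondesc_par u s : par u s -> u \in nondesc par s.
Proof. by move=> us; rewrite nondescE; exact: dag. Qed.

Lemma nondesc_anc s t u : t \in nondesc par s -> connect par u t -> u \in nondesc par s.
Proof. by rewrite !nondescE => nst ut; apply: contra nst => /connect_trans; apply. Qed.

Definition upclosed (V : {set I}) := forall u v, u \in V -> connect par u v -> v \in V.

(** A node of [V] with the fewest ancestors is a source: another node of [V] above it would have
    strictly fewer. *)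
Lemma upclosed_source (V : {set I}) : V != set0 ->
  exists2 t, t \in V & forall u, u \in V -> connect par u t -> u = t.
Proof.
case/set0Pn => t0 t0V.
pose anc t := #|[set u | connect par u t]|.
case: (@arg_minnP _ t0 (fun t => t \in V) anc t0V) => t tV tmin.
exists t => // u uV ut; apply: contraTeq (tmin u uV) => nut.
rewrite -ltnNge; apply: proper_card; apply/properP; split.
  by apply/subsetP => v; rewrite !inE => vu; exact: connect_trans vu ut.
exists t; rewrite !inE ?connect0 //; apply: contra nut => tu.
exact/eqP/connect_antisym.
Qed.

End Graph.

(** * Products of kernels along a DAG *)

Section Kernels.
Variables (I : finType) (par : rel I) (X : I -> finType).
Hypothesis dag : acyclic par.
Implicit Types (z x y : cfg X).

(** A conditional mass function of the variable at [t] given its strict ancestors, encoded on whole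
    configurations: [r z] is the probability of the value [z t] given the values of [z] above
    [t]. *)
Definition kernel (t : I) (r : cfg X -> R) : Prop :=
  [/\ forall z, 0 <= r z, forall z, Rsum (fun a : X t => r (upd z a)) = 1 &
    forall z z', (forall u, connect par u t -> z u = z' u) -> r z = r z'].

Lemma kernel_delta t y : kernel t (fun z => indR (z t == y t)).
Proof.
split=> [z|z|z z' e]; first exact: indR_ge0; last by rewrite e ?connect0.
rewrite (@Rsum_pick _ (y t)) ?upd_same ?eqxx // => a /negbTE.
by rewrite upd_same => ->.
Qed.

Definition pinned (V : {set I}) y (r : I -> cfg X -> R) (t : I) z : R :=
  if t \in V then indR (z t == y t) else r t z.

Lemma kernel_pinned V y r : (forall t, kernel t (r t)) -> forall t, kernel t (pinned V y r t).
Proof.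
move=> kr t; rewrite /pinned; case: (t \in V); [exact: kernel_delta|exact: kr].
Qed.

(** The nodes of [V] are pinned one at a time, a source [t] of [V] last. By then the other nodes of
    [V] carry point masses, and nodes outside [V] do not have [t] as an ancestor, so no other factor
    depends on [z t] and [sum_switch] applies. *)
Lemma sum_pinned (V : {set I}) y r (phi : cfg X -> R) :
  (forall t, kernel t (r t)) -> upclosed par V ->
  (forall z z', (forall u, u \notin V -> z u = z' u) -> phi z = phi z') ->
  Rsum (fun z => phi z * \big[Rmult/1]_t r t z) =
  Rsum (fun z => phi z * \big[Rmult/1]_t pinned V y r t z).
Proof.
move=> kr; have [n] := ubnP #|V|; elim: n V => // n IH V lV upV iphi.
have [->|V0] := eqVneq V set0.
  apply: eq_Rsum => z; congr (_ * _); apply: eq_bigr => t _.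
  by rewrite /pinned inE.
have [t tV tsrc] := upclosed_source dag V0.
rewrite (IH (V :\ t)).
- pose psi z := phi z * \big[Rmult/1]_(u | u != t) pinned V y r u z.
  transitivity (Rsum (fun z => psi z * r t z)).
    apply: eq_Rsum => z; rewrite (bigD1 t) //= {1}/pinned setD11 /psi.
    rewrite (_ : \big[_/_]_(i | _) _ = \big[Rmult/1]_(u | u != t) pinned V y r u z).
      by ring.
    by apply: eq_bigr => u ut; rewrite /pinned in_setD1 ut.
  transitivity (Rsum (fun z => psi z * indR (z t == y t))).
    apply: (@sum_switch _ _ t); last by case: (kernel_delta t y).
      move=> z a; congr (_ * _).
        apply: iphi => u uV; rewrite upd_other //.
        by apply: contraNneq uV => ->.
      apply: eq_bigr => u ut; rewrite /pinned; case: (boolP (u \in V)) => uV.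
        by rewrite upd_other.
      case: (kr u) => _ _; apply => v vu; rewrite upd_other //.
      by apply: contraNneq uV => evt; apply: upV tV _; rewrite -evt.
    by case: (kr t).
  apply: eq_Rsum => z; rewrite [in RHS](bigD1 t) //= /psi (_ : pinned V y r t z = indR (z t == y t)); first by ring.
  by rewrite /pinned tV.
- by rewrite (cardsD1 t) tV in lV.
- move=> u v; rewrite !in_setD1 => /andP[ut uV] uv; rewrite (upV u v) // andbT.
  by apply: contra ut => /eqP evt; apply/eqP/tsrc; rewrite -?evt.
- move=> z z' e; apply: iphi => u uV; apply: e; apply: contra uV.
  by rewrite in_setD1 => /andP[].
Qed.

(** The event leaves the descendants of [s] free, so they may be pinned to [y]. Then [y] is the only
    configuration of the event with a nonzero product, and the factors of the nondescendants see
    only values of [x]. *)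
Lemma mass_kernels_node r s x (a : X s) : (forall t, kernel t (r t)) ->
  mass (fun z => \big[Rmult/1]_t r t z) (ev_node a :&: ev_eq (nondesc par s) x) =
  \big[Rmult/1]_(t in nondesc par s) r t x * r s (upd x a).
Proof.
move=> kr; set y := upd x a; set E := _ :&: _.
have snd t : t \in desc par s -> t \notin nondesc par s.
  by rewrite !inE orbC => ->.
have ndy t : t \in nondesc par s -> y t = x t.
  move=> tn; rewrite /y upd_other //; apply: contraTneq tn => ->.
  by rewrite nondescE connect0.
have Ey : y \in E.
  by rewrite !inE /y upd_same eqxx; apply/forall_inP => t tn; rewrite -(ndy t).
have upV : upclosed par (desc par s).
  move=> u v; rewrite !inE => /andP[us su] uv.
  rewrite (connect_trans su uv) andbT; apply: contra us => /eqP evs.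
  by rewrite evs in uv; rewrite (connect_antisym dag uv su).
rewrite /mass (sum_pinned y kr upV) => [|z z' e].
  rewrite (@Rsum_pick _ y).
    rewrite Ey /= Rmult_1_l (bigD1 s) //= {1}/pinned inE eqxx /= Rmult_comm.
    congr (_ * _); rewrite /pinned (bigID (mem (desc par s))) /= [X in X * _]big1 ?Rmult_1_l.
      apply: eq_big => [t|t]; first by rewrite !inE negb_or negb_and; case: eqVneq => //=; rewrite andbT.
      case/andP=> ts tD; rewrite (negbTE tD); case: (kr t) => _ _; apply => u ut.
      apply: ndy; apply: nondesc_anc ut; move: tD.
      by rewrite nondescE /desc inE ts.
    by move=> t /andP[_ ->]; rewrite eqxx.
  move=> z nzy; case: (boolP (z \in E)) => /= zE; last by ring.
  have [t nt] : exists t, z t != y t.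
    apply/existsP; apply: contraR nzy; rewrite negb_exists => /forallP h.
    by apply/eqP/ffunP => t; apply/eqP; have := h t; rewrite negbK.
  rewrite (bigD1 t) //= /pinned (negbTE nt); case: ifP => [_|tD] /=; first by ring.
  case/negP: nt; move: zE; rewrite in_setI inE => /andP[/eqP zs /in_ev_eqP zN].
  have [->|ts] := eqVneq t s; first by rewrite zs /y upd_same.
  have tN : t \in nondesc par s by rewrite !inE negb_or ts -[_ && _]negbK; move: tD; rewrite inE ts => ->.
  by rewrite zN // ndy.
congr indR; rewrite !inE e; last by rewrite !inE eqxx.
congr (_ && _); apply: eq_forallb => t; case: (boolP (t \in nondesc par s)) => //= tn.
by rewrite e //; apply: contraL tn; exact: snd.
Qed.

Lemma mass_node_split (p : cfg X -> R) s (B : {set cfg X}) :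
  mass p B = Rsum (fun a : X s => mass p (ev_node a :&: B)).
Proof.
rewrite /mass exchange_Rsum; apply: eq_Rsum => z.
rewrite (@Rsum_pick _ (z s)); first by rewrite !inE eqxx.
by move=> a; rewrite !inE eq_sym => /negbTE ->; rewrite /=; ring.
Qed.

Lemma mass_kernels_nondesc r s x : (forall t, kernel t (r t)) ->
  mass (fun z => \big[Rmult/1]_t r t z) (ev_eq (nondesc par s) x) =
  \big[Rmult/1]_(t in nondesc par s) r t x.
Proof.
move=> kr; rewrite (mass_node_split _ s).
rewrite (eq_Rsum (fun a => mass_kernels_node x a kr)) -mulRsum.
by case: (kr s) => _ -> _; ring.
Qed.

(** Once [V] is pinned to [y], every factor is a point mass at [y] wherever [phi] is nonzero, so
    only [y] contributes. This evaluates expectations of functions of nodes that are copied from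
    [y]. *)
Lemma sum_kernels r (phi : cfg X -> R) (V : {set I}) y :
  (forall t, kernel t (r t)) -> upclosed par V ->
  (forall z z', (forall u, u \notin V -> z u = z' u) -> phi z = phi z') ->
  (forall z t, t \notin V -> phi z <> 0 -> r t z = indR (z t == y t)) ->
  Rsum (fun z => phi z * \big[Rmult/1]_t r t z) = phi y.
Proof.
move=> kr upV iphi hd; rewrite (sum_pinned y kr upV iphi) (@Rsum_pick _ y).
  have [->|n0] := Req_dec (phi y) 0; first by ring.
  rewrite big1 ?Rmult_1_r // => t _; rewrite /pinned eqxx; case: ifP => // tV.
  by rewrite hd ?tV // eqxx.
move=> z nzy; have [->|n0] := Req_dec (phi z) 0; first by ring.
have [t nt] : exists t, z t != y t.
  apply/existsP; apply: contraR nzy; rewrite negb_exists => /forallP h.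
  by apply/eqP/ffunP => t; apply/eqP; have := h t; rewrite negbK.
rewrite (bigD1 t) //= /pinned (negbTE nt); case: ifP => [_|tV] /=; first by ring.
by rewrite hd ?tV // (negbTE nt) /=; ring.
Qed.

Lemma sum_kernels1 r y : (forall t, kernel t (r t)) ->
  Rsum (fun z => \big[Rmult/1]_t r t z) = 1.
Proof.
move=> kr; rewrite -[RHS](@sum_kernels r (fun=> 1) setT y kr) //.
- by apply: eq_Rsum => z; rewrite Rmult_1_l.
- by move=> z t; rewrite inE.
Qed.

End Kernels.

(** * Irrelevant natural extensions *)

(** The tower property for conditioning on the coordinates in [S]. As [B] is a union of classes
    [ev_eq S z], the product rule splits [P [set z] B] through the class of [z]; null classes cause
    no trouble because conditionals on them are defined. *)
Lemma fcpm_tower (I : finType) (X : I -> finType) (P : {set cfg X} -> {set cfg X} -> R)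
  (S : {set I}) (B : {set cfg X}) (G phi : cfg X -> R) :
  fcpm P -> B != set0 ->
  (forall z z', z' \in ev_eq S z -> (z' \in B) = (z \in B)) ->
  (forall z z', z' \in ev_eq S z -> G z' = G z) ->
  Rsum (fun z => G z * phi z * P [set z] B) =
  Rsum (fun z => G z * P [set z] B * Rsum (fun z' => phi z' * P [set z'] (ev_eq S z))).
Proof.
move=> fP B0 satB invG.
have PB z : P [set z] B = indR (z \in B) * P [set z] (ev_eq S z) * P (ev_eq S z) B.
  case: (boolP (z \in B)) => zB /=; last by rewrite fcpm_set1_notin //; ring.
  have sub : ev_eq S z :&: B = ev_eq S z.
    by apply/setIidPl/subsetP => z' /satB ->.
  have := @fcpm_cap _ P fP [set z] B (ev_eq S z).
  rewrite sub (_ : [set z] :&: _ = [set z]); last first.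
    by apply/setIidPl; rewrite sub1set ev_eq_refl.
  by move=> ->; [ring | exact: ev_eq_neq0].
have Pc z z' : P [set z'] (ev_eq S z) = indR (z' \in ev_eq S z) * P [set z'] (ev_eq S z').
  case: (boolP (z' \in ev_eq S z)) => /= [/in_ev_eqP/eq_ev_eq ->|h]; first by ring.
  by rewrite (fcpm_set1_notin fP (ev_eq_neq0 _ _) h); ring.
(* A factor 1 is inserted, the total mass of the class of [z']. Within a class [z] and [z'] can then
   be interchanged. *)
transitivity (Rsum (fun z' => Rsum (fun z =>
    G z' * phi z' * P [set z'] B * P [set z] (ev_eq S z')))).
  apply: eq_Rsum => z'; rewrite -mulRsum fcpm_Rsum ?ev_eq_neq0 //; ring.
rewrite exchange_Rsum; apply: eq_Rsum => z; rewrite mulRsum; apply: eq_Rsum => z'.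
rewrite (Pc z z') (Pc z' z) ev_eq_sym.
case: (boolP (z' \in ev_eq S z)) => /= zz'; last by ring.
rewrite (invG _ _ zz') !PB (satB _ _ zz') (eq_ev_eq (in_ev_eqP _ _ _ zz')).
by ring.
Qed.

Section CredalNetwork.
Variables (I : finType) (par : rel I) (X : I -> finType).
Variable M : forall s : I, cfg X -> (X s -> R) -> Prop.
Arguments M : clear implicits.
Hypothesis dag : acyclic par.
Hypothesis HM : local_models par M.
Implicit Types (z x y : cfg X).

Lemma local_dep s x y p : (forall u, par u s -> x u = y u) -> M s x p -> M s y p.
Proof. by case: (HM s) => h _ /h e /e. Qed.

Lemma local_pmf s x (p : X s -> R) : M s x p -> is_pmf p.
Proof. by case: (HM s) => _ [_ [h _]]; exact: h. Qed.

(** Convexity is iterated along a list, each partial sum being normalised by its weight. The case of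
    weight 0 is carried separately, since [m t] is only known to lie in the local model when [lam t]
    is nonzero. *)
Lemma local_mix s x (T : finType) (lam : T -> R) (m : T -> X s -> R) :
  (forall t, 0 <= lam t) -> Rsum lam = 1 -> (forall t, lam t <> 0 -> M s x (m t)) ->
  M s x (fun a => Rsum (fun t => lam t * m t a)).
Proof.
move=> l0 l1 hm; case: (HM s) => _ [_ [_ [cvx _]]].
pose W (r : seq T) := \big[Rplus/0]_(t <- r) lam t.
pose F (r : seq T) a := \big[Rplus/0]_(t <- r) (lam t * m t a).
have : forall r, (W r = 0 /\ forall a, F r a = 0) \/
    (0 < W r /\ M s x (fun a => F r a / W r)).
  elim=> [|t r IH]; first by left; rewrite /W /F; split=> [|a]; rewrite big_nil.
  have We : W (t :: r) = lam t + W r by rewrite /W big_cons.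
  have Fe a : F (t :: r) a = lam t * m t a + F r a by rewrite /F big_cons.
  have [lt0|ltn0] := Req_dec (lam t) 0.
    case: IH => [[W0 F0]|[W0 Mr]].
      by left; rewrite We lt0 W0; split=> [|a]; rewrite ?Fe ?F0 ?lt0; ring.
    right; rewrite We lt0 Rplus_0_l; split=> //.
    rewrite (_ : (fun a => _) = (fun a => F r a / W r)) //.
    by apply: functional_extensionality => a; rewrite Fe lt0 Rmult_0_l Rplus_0_l.
  have ltp : 0 < lam t by have := l0 t; lra.
  right; case: IH => [[W0 F0]|[W0 Mr]].
    rewrite We W0; split; first by lra.
    rewrite (_ : (fun a => _) = m t); first exact: hm.
    by apply: functional_extensionality => a; rewrite Fe F0; field.
  rewrite We; split; first by lra.
  have := cvx x _ _ (lam t / (lam t + W r)) (hm t ltn0) Mr.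
  set A := (fun a => _); set A' := (fun a => _).
  have -> : A = A'; last apply.
    by apply: functional_extensionality => a; rewrite /A /A' Fe; field; lra.
  split; first by apply: Rmult_le_pos; [lra | left; apply: Rinv_0_lt_compat; lra].
  apply: (Rmult_le_reg_r (lam t + W r)); first by lra.
  rewrite /Rdiv Rmult_assoc Rinv_l; lra.
move/(_ (index_enum T)); rewrite (_ : W _ = 1) //.
case=> [[]|[_]]; first by lra.
rewrite (_ : (fun a => _ / 1) = (fun a => Rsum (fun t => lam t * m t a))) //.
by apply: functional_extensionality => a; rewrite /F /Rsum; field.
Qed.

(** By the tower property the law given [S] is a mixture of the laws given all nondescendants of
    [s]. The components of nonzero weight share the values of the parents, which lie in [S], hence
    belong to one convex local model. *)
Lemma irr_ext_cond P s (S : {set I}) x : irr_ext par M P ->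
  parents par s \subset S -> S \subset nondesc par s ->
  M s x (fun a : X s => P (ev_node a) (ev_eq S x)).
Proof.
move=> [fP irr] /subsetP sPS sSN; have B0 := ev_eq_neq0 S x.
rewrite (_ : (fun a => _) = (fun a => Rsum (fun z => P [set z] (ev_eq S x) *
    P (ev_node a) (ev_eq (nondesc par s) z)))).
  apply: local_mix => [z||z]; [exact: fcpm_ge0 | exact: fcpm_Rsum |].
  case: (boolP (z \in ev_eq S x)) => [/in_ev_eqP zx _|zx []]; last exact: fcpm_set1_notin.
  by apply: local_dep (irr s z) => u us; apply: zx; apply: sPS; rewrite inE.
apply: functional_extensionality => a.
have := @fcpm_tower _ _ P (nondesc par s) _ (fun=> 1) (fun z => indR (z \in ev_node a)) fP B0.
rewrite (fcpm_mass fP) // /mass => e; rewrite (_ : Rsum _ = Rsum (fun z =>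
  1 * indR (z \in ev_node a) * P [set z] (ev_eq S x))); last by apply: eq_Rsum => z; ring.
rewrite e // => [|z z' /(subsetP (sub_ev_eq _ sSN)) /in_ev_eqP h]; last first.
  rewrite ev_eq_sym [RHS]ev_eq_sym (eq_ev_eq (y := z)) // => t tS; exact: h.
by apply: eq_Rsum => z; rewrite [P (ev_node a) _](fcpm_mass fP) ?ev_eq_neq0 // /mass Rmult_1_l.
Qed.

Variable x0 : cfg X.

(** Choosing at the configuration that keeps the parents' values and takes all others from [x0]
    makes the selection depend on the parents only. *)
Definition local_pick t z : X t -> R :=
  epsilon (inhabits (fun=> 0)) (M t (glue (restr (parents par t) z) x0)).

Lemma local_pickP t z : M t z (local_pick (t := t) z).
Proof.
case: (HM t) => _ [ex _].
apply: (@local_dep t (glue (restr (parents par t) z) x0)).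
  by move=> u ut; rewrite glue_restr ?inE.
exact: epsilon_spec.
Qed.

Lemma local_pick_dep t z z' : (forall u, par u t -> z u = z' u) ->
  local_pick (t := t) z = local_pick z'.
Proof.
move=> e; rewrite /local_pick (_ : restr _ z = restr (parents par t) z') //.
by apply: eq_restr => u; rewrite inE; exact: e.
Qed.

Definition pick_kernel t z : R := local_pick z (z t).

Lemma pick_kernel_upd t z (a : X t) : pick_kernel t (upd z a) = local_pick z a.
Proof.
rewrite /pick_kernel upd_same (@local_pick_dep t _ z) // => u ut.
by rewrite upd_other ?(par_neq dag ut).
Qed.

Lemma kernel_pick t : kernel par t (pick_kernel t).
Proof.
have pm z := local_pmf (@local_pickP t z).
split=> [z|z|z z' e]; first by case: (pm z) => h _; exact: h.
  by rewrite (eq_Rsum (@pick_kernel_upd t z)); case: (pm z).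
rewrite /pick_kernel (@local_pick_dep t z z') ?e ?connect0 // => u ut.
by apply: e; exact: connect1.
Qed.

(** A division-free way to say that the law of node [s] given its nondescendants is in the local
    model; it is satisfied with [C = 0] when the conditioning event is null. *)
Definition node_factor (p : cfg X -> R) s x : Prop :=
  exists (m : X s -> R) (C : R), M s x m /\
    forall a, mass p (ev_node a :&: ev_eq (nondesc par s) x) = m a * C.

Lemma node_factor_cond (p : cfg X -> R) s x : node_factor p s x ->
  0 < mass p (ev_eq (nondesc par s) x) ->
  M s x (fun a : X s => mass p (ev_node a :&: ev_eq (nondesc par s) x) /
                      mass p (ev_eq (nondesc par s) x)).
Proof.
case=> m [C [Mm e]]; rewrite (mass_node_split p s) (eq_Rsum e).
have -> : Rsum (fun a => m a * C) = C.
  have [_ m1] := local_pmf Mm.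
  by rewrite (eq_Rsum (fun a => Rmult_comm (m a) C)) -mulRsum m1; ring.
move=> C0; rewrite (_ : (fun a => _) = m) //.
by apply: functional_extensionality => a; rewrite e; field; lra.
Qed.

(* Below [p], layer [n.+1] lets [n] nodes be pinned to arbitrary values instead
   of following their local model: a conditioning event on the nondescendants
   of [s] is first charged by configurations where [s] is not pinned, since
   unpinning [s] does not change the mass of that event. *)
Lemma irr_ext_of_pmf (p : cfg X -> R) :
  (forall z, 0 <= p z) -> Rsum p = 1 -> (forall s x, node_factor p s x) ->
  exists2 P, irr_ext par M P & forall z, P [set z] [set: cfg X] = p z.
Proof.
move=> p0 p1 pf.
pose pin (j : {set I} * cfg X) z :=
  \big[Rmult/1]_t pinned j.1 j.2 pick_kernel t z.
pose layer (n : nat) z := Rsum (fun j : {set I} * cfg X => indR (#|j.1| == n) * pin j z).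
have kpin (j : {set I} * cfg X) t := kernel_pinned j.1 j.2 kernel_pick t.
have pin0 j z : 0 <= pin j z.
  by apply: prodR_ge0 => t; case: (kpin j t).
have layer0 n z : 0 <= layer n z.
  by apply: Rsum_ge0 => j; apply: Rmult_le_pos; [exact: indR_ge0 | exact: pin0].
have mass_layer n E : mass (layer n) E =
    Rsum (fun j : {set I} * cfg X => indR (#|j.1| == n) * mass (pin j) E).
  rewrite /mass /layer (_ : Rsum _ = Rsum (fun z => Rsum (fun j : {set I} * cfg X =>
    indR (z \in E) * (indR (#|j.1| == n) * pin j z)))); last first.
    by apply: eq_Rsum => z; rewrite mulRsum.
  rewrite exchange_Rsum; apply: eq_Rsum => j; rewrite mulRsum.
  by apply: eq_Rsum => z; ring.
pose L n := if n is n'.+1 then layer n' else p.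
have L0 n z : 0 <= L n z by case: n => [|n]; [exact: p0 | exact: layer0].
have Lpos z : exists n, 0 < L n z.
  (* The layer with all nodes pinned, its index shifted by one because layer 0 is [p]; it charges
     [z] through the term pinned to [z] itself. *)
  exists #|I|.+1 => /=.
  apply: Rlt_le_trans (Rsum_ge_term ([set: I], z) _) => [|j] /=.
    rewrite cardsT eqxx /= Rmult_1_l /pin big1; first by lra.
    by move=> t _; rewrite /pinned inE eqxx.
  by apply: Rmult_le_pos; [exact: indR_ge0 | exact: pin0].
have [P fP PL] := fcpm_layers L0 Lpos; exists P; last first.
  move=> z; have T0 : [set: cfg X] != set0 by apply/set0Pn; exists z; rewrite inE.
  (* Layer 0 has total mass 1, so it is the first to charge the sure event. *)
  have [[|n] [n1 n2 ->]] := PL _ T0; last first.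
    by have := n2 0%N isT; rewrite mass_setT p1; lra.
  by rewrite setIT mass_set1 mass_setT p1 Rdiv_1_r.
split=> // s x; set B := ev_eq _ x.
have [n [n1 n2 PE]] := PL B (ev_eq_neq0 _ _).
suff nf : node_factor (L n) s x.
  have := node_factor_cond nf n1; set f := (fun a => _); set f' := (fun a => _).
  by have -> : f = f' by apply: functional_extensionality => a; rewrite /f /f' PE.
case: n n1 n2 {PE} => [|n] n1 n2; first exact: pf.
exists (local_pick x), (mass (layer n) B); split; first exact: local_pickP.
move=> a; rewrite /= !mass_layer mulRsum; apply: eq_Rsum => -[U y] /=.
have [cU|_] := eqVneq #|U| n; last by rewrite /=; ring.
rewrite (mass_kernels_node dag x a (kpin (U, y))) (mass_kernels_nondesc dag s x (kpin (U, y))).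
rewrite /= !Rmult_1_l; set Q := \big[_/_]_(_ | _) _.
have [sU|sU] := boolP (s \in U); last first.
  by rewrite /pinned (negbTE sU) pick_kernel_upd; ring.
(* [Q] is also the mass of [B] under the term for [U :\ s], which belongs to the preceding layer,
   and that layer does not charge [B]. *)
suff -> : Q = 0 by ring.
case: n n1 n2 cU => [|n] n1 n2 cU.
  by move: sU; move/eqP: cU; rewrite cards_eq0 => /eqP ->; rewrite inE.
have := n2 n.+1 (ltnSn _); rewrite /= mass_layer => h.
have := @Rsum_ge_term _ (U :\ s, y) (fun j : {set I} * cfg X => indR (#|j.1| == n) * mass (pin j) B).
rewrite h /= (_ : #|U :\ s| == n); last by rewrite -eqSS -cU (cardsD1 s U) sU.
rewrite (mass_kernels_nondesc dag s x (kpin (U :\ s, y))) /= Rmult_1_l.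
have Q0 : 0 <= Q by apply: prodR_ge0 => t; case: (kpin (U, y) t).
rewrite (_ : \big[_/_]_(_ | _) _ = Q) => [hQ|].
  suff : Q <= 0 by lra.
  by apply: hQ => j; apply: Rmult_le_pos; [exact: indR_ge0 | exact: mass_ge0].
apply: eq_bigr => t; rewrite nondescE /pinned in_setD1 => ts.
by have -> : t != s by apply: contraNneq ts => ->; exact: connect0.
Qed.

(** * Mixtures of kernel products with frozen nodes *)

Section Mixture.
Variables (J : finType) (w : J -> R) (y : J -> cfg X) (frozen : I -> cfg X -> bool).
Hypothesis w0 : forall j, 0 <= w j.
Hypothesis w1 : Rsum w = 1.
Hypothesis frozen_dep : forall t z z',
  (forall u, connect par u t -> u != t -> z u = z' u) -> frozen t z = frozen t z'.
Hypothesis frozen_factor : forall s x, frozen s x ->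
  exists (m : X s -> R) (C : R), M s x m /\ forall a,
    Rsum (fun j => w j * (indR [forall (t | (t \in nondesc par s) && frozen t x), x t == y j t]
                          * indR (a == y j s))) = m a * C.

Definition frozen_kernel j t z : R :=
  if frozen t z then indR (z t == y j t) else pick_kernel t z.

Lemma frozen_upd t z (a : X t) : frozen t (upd z a) = frozen t z.
Proof. by apply: frozen_dep => u _ ut; rewrite upd_other. Qed.

Lemma kernel_frozen j t : kernel par t (frozen_kernel j t).
Proof.
have [d0 d1 d2] := kernel_delta par t (y j); have [k0 k1 k2] := kernel_pick t.
rewrite /frozen_kernel; split=> [z|z|z z' e]; first by case: ifP.
  case: (boolP (frozen t z)) => fz.
    rewrite -[RHS](d1 z); apply: eq_Rsum => a; by rewrite frozen_upd fz.
  rewrite -[RHS](k1 z); apply: eq_Rsum => a; by rewrite frozen_upd (negbTE fz).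
rewrite (@frozen_dep t z z') => [|u ut _]; last exact: e.
by case: ifP => _; [exact: d2 | exact: k2].
Qed.

(** For an unfrozen [s] the law given the nondescendants is the local pick, whatever [j]. For a
    frozen [s] the nondescendants inform about [j] only through those that are frozen, and
    [frozen_factor] treats exactly this information. *)
Lemma irr_ext_mixture : exists2 P, irr_ext par M P & forall z,
  P [set z] [set: cfg X] = Rsum (fun j => w j * \big[Rmult/1]_t frozen_kernel j t z).
Proof.
pose pj j z := \big[Rmult/1]_t frozen_kernel j t z.
have pj0 j z : 0 <= pj j z by apply: prodR_ge0 => t; case: (kernel_frozen j t).
apply: irr_ext_of_pmf => [z||s x].
- by apply: Rsum_ge0 => j; apply: Rmult_le_pos; [exact: w0 | exact: pj0].
- rewrite exchange_Rsum -[RHS]w1; apply: eq_Rsum => j.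
  by rewrite -mulRsum (sum_kernels1 dag (y j) (kernel_frozen j)); ring.
have massE (a : X s) : mass (fun z => Rsum (fun j => w j * pj j z)) (ev_node a :&: ev_eq (nondesc par s) x) =
    Rsum (fun j => w j * (\big[Rmult/1]_(t in nondesc par s) frozen_kernel j t x *
                          frozen_kernel j s (upd x a))).
  rewrite /mass (_ : Rsum _ = Rsum (fun z => Rsum (fun j =>
    indR (z \in ev_node a :&: ev_eq (nondesc par s) x) * (w j * pj j z)))); last first.
    by apply: eq_Rsum => z; rewrite mulRsum.
  rewrite exchange_Rsum; apply: eq_Rsum => j.
  rewrite -(mass_kernels_node dag x a (kernel_frozen j)) /mass mulRsum.
  by apply: eq_Rsum => z; rewrite /pj; ring.
case: (boolP (frozen s x)) => fs; last first.
  exists (local_pick x), (Rsum (fun j => w j * \big[Rmult/1]_(t in nondesc par s) frozen_kernel j t x)).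
  split; first exact: local_pickP.
  move=> a; rewrite massE mulRsum; apply: eq_Rsum => j.
  by rewrite {2}/frozen_kernel frozen_upd (negbTE fs) pick_kernel_upd; ring.
have [m [C [Mm e]]] := frozen_factor fs.
(* The factors of the unfrozen nondescendants do not involve [j] and are absorbed into the
   constant. *)
pose D := \big[Rmult/1]_(t | (t \in nondesc par s) && ~~ frozen t x) pick_kernel t x.
exists m, (C * D); split=> // a; rewrite massE -Rmult_assoc -e Rmult_comm mulRsum.
apply: eq_Rsum => j; rewrite {2}/frozen_kernel frozen_upd fs upd_same -prod_indR.
rewrite (bigID (fun t => frozen t x)) /= (_ : \big[_/_]_(i | _ && ~~ _) _ = D); last first.
  by apply: eq_bigr => t /andP[_ nf]; rewrite /frozen_kernel (negbTE nf).
set E := \big[_/_]_(_ | _) _; set E' := \big[_/_]_(_ | _) _.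
have -> : E = E' by apply: eq_bigr => t /andP[_ f]; rewrite /frozen_kernel f.
ring.
Qed.

End Mixture.

Lemma irr_ext_nonempty : exists P, irr_ext par M P.
Proof.
have w0 (j : unit) : 0 <= 1 by lra.
have w1 : Rsum (fun _ : unit => 1) = 1 by rewrite (@Rsum_pick _ tt) // => -[].
(* A single component with no frozen node is the product of the local picks. *)
have [//|//|P irr _] := @irr_ext_mixture _ _ (fun=> x0) (fun _ _ => false) w0 w1.
by exists P.
Qed.

Definition expect (P : {set cfg X} -> {set cfg X} -> R) (f : cfg X -> R) : R :=
  Rsum (fun z => f z * P [set z] [set: cfg X]).

(** The set of expectations is nonempty by [irr_ext_nonempty] and bounded below by minus the sum of
    [Rabs (f z)], so the infimum chosen in [Rinf] exists. Completeness yields suprema, hence the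
    passage to negated values. *)
Lemma lowE_glb f : is_glb (fun v => exists P, irr_ext par M P /\ v = expect P f) (lowE par M f).
Proof.
pose S v := exists P, irr_ext par M P /\ v = expect P f.
apply: (epsilon_spec _ (is_glb S)).
have [P0 irr0] := irr_ext_nonempty.
have [||m [ub lub]] := completeness (fun v => S (- v)).
- exists (Rsum (fun z => Rabs (f z))) => v Sv.
  have [P irrP e] : exists2 P, irr_ext par M P & - v = expect P f.
    by case: Sv => P [irrP e]; exists P.
  case: irrP => fP _.
  have T0 : [set: cfg X] != set0 by apply/set0Pn; exists x0; rewrite inE.
  rewrite -(Ropp_involutive v) e /expect -Rsum_opp; apply: Rsum_le => z.
  have h0 := fcpm_ge0 fP [set z] T0.
  have h1 : P [set z] setT <= 1.
    rewrite -(fcpm_Rsum fP T0); apply: (Rsum_ge_term z (F := fun z => P [set z] setT)).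
    by move=> t; exact: fcpm_ge0.
  have := Rabs_pos (f z); have := Rle_abs (- f z); rewrite Rabs_Ropp => h2 h3.
  have := Rmult_le_compat_r _ _ _ h0 h2; have := Rmult_le_compat_l _ _ _ h3 h1; lra.
- by exists (- expect P0 f), P0; rewrite Ropp_involutive.
exists (- m); split=> [v Sv|v hv].
  by have := ub (- v); rewrite Ropp_involutive => /(_ Sv); lra.
suff : m <= - v by lra.
by apply: lub => u /hv; lra.
Qed.

Lemma lowE_le P f : irr_ext par M P -> lowE par M f <= expect P f.
Proof. by move=> irr; have [h _] := lowE_glb f; apply: h; exists P. Qed.

Lemma le_lowE v f : (forall P, irr_ext par M P -> v <= expect P f) -> v <= lowE par M f.
Proof.
by move=> h; have [_ hg] := lowE_glb f; apply: hg => u [P [irr ->]]; exact: h.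
Qed.

End CredalNetwork.

(** * Sub-networks *)

Section SubNetwork.
Variables (I : finType) (par : rel I) (X : I -> finType).
Variable M : forall s : I, cfg X -> (X s -> R) -> Prop.
Arguments M : clear implicits.
Hypothesis dag : acyclic par.
Hypothesis HM : local_models par M.
Implicit Types (z x y : cfg X) (K A : {set I}).

Lemma connect_par_sub K (a b : Defs.sub K) :
  connect (par_sub par K) a b -> connect par (val a) (val b).
Proof.
case/connectP => p; elim: p a => [|c p IH] a /= => [_ ->|/andP[ac cp] eb].
  exact: connect0.
exact: connect_trans (@connect1 _ par (val a) (val c) ac) (IH _ cp eb).
Qed.

(** Closedness keeps every node of a path between two nodes of [K] inside [K]. *)
Lemma connect_closedK K (a b : Defs.sub K) : closedK par K ->
  connect (par_sub par K) a b = connect par (val a) (val b).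
Proof.
move=> clK; apply/idP/idP; first exact: connect_par_sub.
case/connectP => p; elim: p a => [|c p IH] a /= => [_ /val_inj ->|/andP[ac cp] eb].
  exact: connect0.
have cK : c \in K.
  apply: (clK (val a) c (val b) (valP a) (valP b) (connect1 ac)).
  by apply/connectP; exists p.
pose c' : Defs.sub K := exist _ c cK.
exact: connect_trans (@connect1 _ (par_sub par K) a c' ac) (IH c' cp eb).
Qed.

Lemma acyclic_par_sub K : acyclic (par_sub par K).
Proof. by move=> a b ab; apply: contra (dag ab); exact: connect_par_sub. Qed.

Lemma nondesc_par_sub K (a b : Defs.sub K) : closedK par K ->
  (b \in nondesc (par_sub par K) a) = (val b \in nondesc par (val a)).
Proof. by move=> clK; rewrite !nondescE connect_closedK. Qed.

Lemma local_models_sub K x : local_models (par_sub par K) (M_sub M K x).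
Proof.
move=> a; have [dep [ex [pmf [cvx clo]]]] := HM (val a).
split=> [z z' e|].
  apply: dep => u ua; case: (boolP (u \in K)) => uK; last by rewrite !glue_out.
  have := glue_in z' x (exist _ u uK); have := glue_in z x (exist _ u uK) => /= -> ->.
  exact: (e (exist _ u uK) ua).
split=> [z|]; first exact: ex.
split=> [z|]; first exact: pmf.
by split=> z; [exact: cvx | exact: clo].
Qed.

Lemma irr_ext_sub_dep K x y P : (forall u, u \in parK par K -> x u = y u) ->
  irr_ext (par_sub par K) (M_sub M K x) P -> irr_ext (par_sub par K) (M_sub M K y) P.
Proof.
move=> exy [fP irr]; split=> // a z.
apply: (local_dep HM) (irr a z) => u ua; case: (boolP (u \in K)) => uK.
  have := glue_in z x (exist _ u uK); by have := glue_in z y (exist _ u uK) => /= -> ->.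
rewrite !glue_out // exy // inE uK /=; apply/bigcupP; exists (val a); first exact: valP a.
by rewrite inE.
Qed.

(** A conditioning event of the sub-network, joined with the values on [A], fixes a set [S] of nodes
    lying between the parents and the nondescendants in the whole graph, so [irr_ext_cond] applies.
    It serves both for marginals ([A] empty) and for conditionals on [K] given [ndK par K]. *)
Lemma irr_ext_restr P K A z : irr_ext par M P -> closedK par K -> [disjoint A & K] ->
  (forall s, s \in K -> parents par s \subset A :|: K) ->
  (forall s, s \in K -> A \subset nondesc par s) ->
  irr_ext (par_sub par K) (M_sub M K z)
    (fun E B => P (restr K @^-1: E) (restr K @^-1: B :&: ev_eq A z)).
Proof.
move=> irr clK dAK sP sN; have [fP _] := irr.
split.
  apply: fcpm_preim => // k; exists (glue k z); last exact: restr_glue.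
  by apply/in_ev_eqP => s sA; rewrite glue_out // (disjointFr dAK sA).
move=> a k; rewrite /M_sub.
pose S := A :|: [set s in K | s \in nondesc par (val a)].
have -> : restr K @^-1: ev_eq (nondesc (par_sub par K) a) k :&: ev_eq A z =
    ev_eq S (glue k z).
  apply/setP => y; rewrite in_setI inE.
  apply/andP/in_ev_eqP => [[/in_ev_eqP h1 /in_ev_eqP h2] s|h].
    rewrite in_setU inE => /orP[sA|/andP[sK sn]].
      by rewrite h2 // glue_out // (disjointFr dAK sA).
    have := h1 (exist _ s sK); rewrite nondesc_par_sub // => /(_ sn).
    by rewrite restrE -(glue_in k z) /=.
  split; apply/in_ev_eqP => s sS.
    rewrite restrE h ?glue_in // in_setU inE (valP s).
    by move: sS; rewrite nondesc_par_sub // => ->; rewrite orbT.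
  by rewrite h ?in_setU ?sS // glue_out // (disjointFr dAK sS).
rewrite (_ : (fun b => _) = (fun b : X (val a) => P (ev_node b) (ev_eq S (glue k z)))).
  apply: (irr_ext_cond HM _ irr).
    apply/subsetP => u ua; have := subsetP (sP _ (valP a)) u ua.
    rewrite !in_setU => /orP[->//|uK]; apply/orP; right; rewrite inE uK /=.
    by apply: nondesc_par => //; rewrite inE in ua.
  apply/subsetP => u; rewrite in_setU inE => /orP[uA|/andP[]//].
  exact: (subsetP (sN _ (valP a))).
apply: functional_extensionality => b; congr (P _ _).
by apply/setP => y; rewrite !inE restrE.
Qed.

Lemma sum_restr P K (B : {set cfg X}) (phi : cfg (Xsub X K) -> R) : fcpm P -> B != set0 ->
  Rsum (fun w => phi w * P (restr K @^-1: [set w]) B) =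
  Rsum (fun z => phi (restr K z) * P [set z] B).
Proof.
move=> fP B0.
transitivity (Rsum (fun w => Rsum (fun z => phi w * (indR (restr K z == w) * P [set z] B)))).
  apply: eq_Rsum => w; rewrite fcpm_mass // /mass mulRsum.
  by apply: eq_Rsum => z; rewrite !inE.
rewrite exchange_Rsum; apply: eq_Rsum => z.
rewrite (@Rsum_pick _ (restr K z)) ?eqxx /=; first by ring.
by move=> w; rewrite eq_sym => /negbTE ->; rewrite /=; ring.
Qed.

End SubNetwork.

(** * Nondescendants and descendants of a closed set *)

Section ClosedSet.
Variables (I : finType) (par : rel I) (K : {set I}).
Hypothesis dag : acyclic par.
Hypothesis clK : closedK par K.

Lemma ndKE t : (t \in ndK par K) = ~~ [exists k in K, connect par k t].
Proof.
rewrite !inE; congr (~~ _); case: (boolP (t \in K)) => tK /=.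
  by apply/esym/exists_inP; exists t => //; exact: connect0.
apply/bigcupP/exists_inP => -[k kK].
  by rewrite inE => /andP[_ kt]; exists k.
move=> kt; exists k => //; rewrite inE kt andbT.
by apply: contraNneq tK => ->.
Qed.

Lemma ndK_anc u t : t \in ndK par K -> connect par u t -> u \in ndK par K.
Proof.
rewrite !ndKE => nt ut; apply: contra nt => /exists_inP[k kK ku].
by apply/exists_inP; exists k => //; exact: connect_trans ku ut.
Qed.

Lemma closed_ndK : closedK par (ndK par K).
Proof. by move=> s k t _ tN _ kt; exact: ndK_anc tN kt. Qed.

Lemma ndK_disjoint : [disjoint ndK par K & K].
Proof.
rewrite -setI_eq0; apply/eqP/setP => t; rewrite !inE.
by case: (t \in K); rewrite ?andbF.
Qed.

Lemma ndK_nondesc s : s \in K -> ndK par K \subset nondesc par s.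
Proof.
move=> sK; apply/subsetP => t; rewrite ndKE nondescE; apply: contra => st.
by apply/exists_inP; exists s.
Qed.

Lemma parKP u : reflect (u \notin K /\ exists2 s, s \in K & par u s) (u \in parK par K).
Proof.
rewrite inE; apply: (iffP andP) => -[uK].
  by case/bigcupP => s sK; rewrite inE => us; split=> //; exists s.
by case=> s sK us; split=> //; apply/bigcupP; exists s; rewrite ?inE.
Qed.

(** A parent of [K] that descended from [K] would lie between two nodes of [K], hence in [K] by
    closedness. *)
Lemma parK_ndK u : u \in parK par K -> u \in ndK par K.
Proof.
case/parKP => uK [s sK us]; rewrite ndKE; apply: contra uK => /exists_inP[k kK ku].
exact: clK kK sK ku (connect1 us).
Qed.

Lemma par_ndKU s : s \in K -> parents par s \subset ndK par K :|: K.
Proof.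
move=> sK; apply/subsetP => u; rewrite in_setU [u \in parents _ _]inE => us.
case: (boolP (u \in K)) => uK; first by rewrite orbT.
by rewrite orbF; apply/parK_ndK/parKP; split=> //; exists s.
Qed.

Lemma upclosed_setC_ndK : upclosed par (~: ndK par K).
Proof. by move=> u v; rewrite (in_setC u) (in_setC v) => nu uv; apply: contra nu => vN; exact: ndK_anc vN uv. Qed.

(** The set is [descK par K], written as a complement; by closedness a path that has left [K] never
    enters it again. *)
Lemma upclosed_descK : upclosed par (~: (ndK par K :|: K)).
Proof.
move=> u v; rewrite (in_setC u) (in_setC v) !in_setU !negb_or => /andP[uN uK] uv.
rewrite (contra (fun vN => ndK_anc vN uv) uN) /=; apply: contra uK => vK.
move: uN; rewrite ndKE negbK => /exists_inP[k kK ku].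
exact: clK kK vK ku uv.
Qed.

End ClosedSet.

(** * Gluing extensions of the two sub-networks *)

Section Factorisation.
Variables (I : finType) (par : rel I) (X : I -> finType).
Variable M : forall s : I, cfg X -> (X s -> R) -> Prop.
Arguments M : clear implicits.
Hypothesis dag : acyclic par.
Hypothesis HM : local_models par M.
Variables (K : {set I}) (x : cfg X).
Hypothesis clK : closedK par K.
Implicit Types (z y : cfg X).
Local Notation N := (ndK par K).

(** Since [z] agrees with [x] at the parents outside [A], the local model of the sub-network at
    [restr A z] is that of the whole network at [z]. The product rule removes the division, so null
    events are covered. *)
Lemma mass_cond_sub (A : {set I}) P (a : Defs.sub A) (S : {set Defs.sub A})
  (z : cfg X) :
  irr_ext (par_sub par A) (M_sub M A x) P ->
  parents (par_sub par A) a \subset S -> S \subset nondesc (par_sub par A) a ->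
  (forall u, par u (val a) -> u \notin A -> z u = x u) ->
  exists2 m : X (val a) -> R, M (val a) z m & forall b : X (val a),
    mass (fun k => P [set k] [set: cfg (Xsub X A)])
      (ev_node (b : Xsub X A a) :&: ev_eq S (restr A z)) =
    m b * mass (fun k => P [set k] [set: cfg (Xsub X A)]) (ev_eq S (restr A z)).
Proof.
move=> irr pS Sn zx; have [fP _] := irr; set B := ev_eq S _.
have T0 : [set: cfg (Xsub X A)] != set0 by apply/set0Pn; exists (restr A z); rewrite inE.
exists (fun b : X (val a) => P (ev_node (b : Xsub X A a)) B).
  have := irr_ext_cond (local_models_sub HM x) (restr A z) irr pS Sn.
  apply: (local_dep HM) => u ua; case: (boolP (u \in A)) => uA; first by rewrite glue_restr.
  by rewrite glue_out // zx.
move=> b; rewrite -!fcpm_mass //.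
by rewrite (fcpm_cap fP) ?setIT ?ev_eq_neq0.
Qed.

(** Testing only those nodes of [parK par K] that are ancestors of [t] makes this a function of the
    strict ancestors of [t], so that copying a value is still a kernel. *)
Definition frozen (t : I) (z : cfg X) : bool :=
  (t \in N) || (t \in K) && [forall u in parK par K, connect par u t ==> (z u == x u)].

Lemma frozen_anc t z z' : (forall u, connect par u t -> u != t -> z u = z' u) ->
  frozen t z = frozen t z'.
Proof.
move=> e; rewrite /frozen; case: (t \in N) => //=.
case: (boolP (t \in K)) => //= tK; apply: eq_forallb => u.
case: (boolP (u \in parK par K)) => //= uP; case: (boolP (connect par u t)) => //= ut.
rewrite e //; apply: contraTneq tK => <-.
by have /parKP[] := uP.
Qed.

Section Product.
Variables (P1 : {set cfg (Xsub X N)} -> {set cfg (Xsub X N)} -> R).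
Variables (P2 : {set cfg (Xsub X K)} -> {set cfg (Xsub X K)} -> R).
Hypothesis irr1 : irr_ext (par_sub par N) (M_sub M N x) P1.
Hypothesis irr2 : irr_ext (par_sub par K) (M_sub M K x) P2.

Definition weight (j : cfg (Xsub X N) * cfg (Xsub X K)) : R :=
  P1 [set j.1] setT * P2 [set j.2] setT.
(** Outside [N] and [K] the values of [x] are mere fillers: such nodes are never frozen. *)
Definition target (j : cfg (Xsub X N) * cfg (Xsub X K)) : cfg X := glue j.2 (glue j.1 x).

Lemma target_N j s : s \in N -> target j s = glue j.1 x s.
Proof. by move=> sN; rewrite /target glue_out // (disjointFr (ndK_disjoint par K) sN). Qed.

Lemma frozen_factor s z : frozen s z ->
  exists (m : X s -> R) (C : R), M s z m /\ forall a,
    Rsum (fun j => weight j *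
      (indR [forall (t | (t \in nondesc par s) && frozen t z), z t == target j t]
       * indR (a == target j s))) = m a * C.
Proof.
move=> fs.
pose S1 := [set a : Defs.sub N | val a \in nondesc par s].
pose S2 := [set a : Defs.sub K | (val a \in nondesc par s) && frozen (val a) z].
have condE j : [forall (t | (t \in nondesc par s) && frozen t z), z t == target j t] =
    (j.1 \in ev_eq S1 (restr N z)) && (j.2 \in ev_eq S2 (restr K z)).
  apply/forall_inP/andP => [hj|[/in_ev_eqP h1 /in_ev_eqP h2] t /andP[tn]].
    split; apply/in_ev_eqP => a; rewrite inE restrE => aS.
      have := hj (val a); rewrite aS /frozen (valP a) => /(_ isT) /eqP ->.
      by rewrite target_N ?(valP a) // glue_in.
    by have := hj (val a) aS => /eqP ->; rewrite /target glue_in.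
  case: (boolP (t \in N)) => tN ft.
    have := h1 (exist _ t tN); rewrite inE restrE target_N // => /(_ tn) /= <-.
    by have := glue_in j.1 x (exist _ t tN) => /= ->.
  have tK : t \in K by move: ft; rewrite /frozen (negbTE tN) => /andP[].
  have := h2 (exist _ t tK); rewrite inE restrE /= tn ft => /(_ isT) <-.
  by have := glue_in j.2 (glue j.1 x) (exist _ t tK) => /= <-.
pose p1 k := P1 [set k] setT; pose p2 k := P2 [set k] setT.
have [sN|sN] := boolP (s \in N).
  pose s' : Defs.sub N := exist _ s sN.
  have S1E : S1 = nondesc (par_sub par N) s'.
    by apply/setP => a; rewrite inE (nondesc_par_sub _ _ (closed_ndK (K := K))).
  have [|||m Mm e] := @mass_cond_sub N P1 s' S1 z irr1.
  - by apply/subsetP => a; rewrite S1E inE; apply: nondesc_par; exact: acyclic_par_sub.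
  - by rewrite S1E.
  - by move=> u us uN; case/negP: uN; exact: ndK_anc sN (connect1 us).
  exists m, (mass p1 (ev_eq S1 (restr N z)) * mass p2 (ev_eq S2 (restr K z))).
  split=> // a; rewrite -Rmult_assoc -e /mass -Rsum_prod; apply: eq_Rsum => j.
  have ej : (j.1 \in ev_node (a : Xsub X N s')) = (a == target j s).
    by rewrite inE eq_sym target_N //; have := glue_in j.1 x s' => /= ->.
  rewrite condE indRM in_setI indRM ej.
  by rewrite /weight /p1 /p2; ring.
have /andP[sK /forall_inP zx] : (s \in K) && [forall u in parK par K, connect par u s ==> (z u == x u)].
  by move: fs; rewrite /frozen (negbTE sN).
pose s' : Defs.sub K := exist _ s sK.
have [|||m Mm e] := @mass_cond_sub K P2 s' S2 z irr2.
(* Ancestors of a parent of [s] are ancestors of [s], so the parents of [s] in [K] are frozen along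
   with [s]. *)
- apply/subsetP => a; rewrite [a \in parents _ _]inE => /= as'.
  rewrite inE nondesc_par //= /frozen (valP a); apply/orP; right.
  apply/forall_inP => u uP; apply/implyP => ua.
  by apply: (implyP (zx u uP)); exact: connect_trans ua (@connect1 _ par (val a) s as').
- by apply/subsetP => a; rewrite inE nondesc_par_sub // => /andP[].
- move=> u us uK; apply/eqP; apply: (implyP (zx u _)); last exact: connect1.
  by apply/parKP; split=> //; exists s.
exists m, (mass p2 (ev_eq S2 (restr K z)) * mass p1 (ev_eq S1 (restr N z))).
split=> // a; rewrite -Rmult_assoc -e Rmult_comm /mass -Rsum_prod; apply: eq_Rsum => j.
have ej : (j.2 \in ev_node (a : Xsub X K s')) = (a == target j s).
  by rewrite inE eq_sym /target; have := glue_in j.2 (glue j.1 x) s' => /= ->.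
rewrite condE indRM in_setI indRM ej.
by rewrite /weight /p1 /p2; ring.
Qed.

Lemma irr_ext_product (H G : cfg (Xsub X N) -> R) (f : cfg (Xsub X K) -> R) :
  (forall w, G w <> 0 -> forall u, u \in parK par K -> glue w x u = x u) ->
  exists2 P, irr_ext par M P &
    expect P (fun z => H (restr N z) + G (restr N z) * f (restr K z)) =
    expect P1 H + expect P1 G * expect P2 f.
Proof.
move=> Gx; have [fP1 _] := irr1; have [fP2 _] := irr2.
have T1 : [set: cfg (Xsub X N)] != set0 by apply/set0Pn; exists (restr N x); rewrite inE.
have T2 : [set: cfg (Xsub X K)] != set0 by apply/set0Pn; exists (restr K x); rewrite inE.
have w0 j : 0 <= weight j by apply: Rmult_le_pos; exact: fcpm_ge0.
have w1 : Rsum weight = 1.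
  transitivity (Rsum (fun k => P1 [set k] setT) * Rsum (fun k => P2 [set k] setT)).
    exact: Rsum_prod.
  by rewrite !fcpm_Rsum //; ring.
have [P irr PE] := irr_ext_mixture dag HM x w0 w1 frozen_anc frozen_factor.
exists P => //.
pose pj j z := \big[Rmult/1]_t frozen_kernel par M x target frozen j t z.
have kj j t := kernel_frozen dag HM x target frozen_anc j t.
have rN j : restr N (target j) = j.1.
  by apply/ffunP => a; rewrite restrE target_N ?(valP a) // glue_in.
have rK j : restr K (target j) = j.2 by exact: restr_glue.
transitivity (Rsum (fun j => weight j *
  (Rsum (fun z => H (restr N z) * pj j z) +
   Rsum (fun z => G (restr N z) * f (restr K z) * pj j z)))).
  transitivity (Rsum (fun z => Rsum (fun j => weight j *
      ((H (restr N z) + G (restr N z) * f (restr K z)) * pj j z)))).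
    apply: eq_Rsum => z; rewrite PE mulRsum; apply: eq_Rsum => j; rewrite /pj; ring.
  rewrite exchange_Rsum; apply: eq_Rsum => j; rewrite -RsumD mulRsum.
  apply: eq_Rsum => z; ring.
transitivity (Rsum (fun j => weight j * (H j.1 + G j.1 * f j.2))).
  apply: eq_Rsum => j; congr (_ * (_ + _)).
    (* All nodes of [N] are copied from [target j], and the others integrate out. *)
    rewrite (sum_kernels dag (y := target j) (kj j) (upclosed_setC_ndK (K := K))) ?rN //.
      move=> z z' e; congr H; apply: eq_restr => s sN; apply: e; by rewrite in_setC negbK.
    by move=> z t; rewrite in_setC negbK => tN _; rewrite /frozen_kernel /frozen tN.
  (* Where [G] is nonzero, [z] agrees with [x] on [parK par K], so the nodes of [K] are copied as
     well and only the descendants of [K] integrate out. *)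
  rewrite (sum_kernels dag (y := target j) (kj j) (upclosed_descK clK)) ?rN ?rK //.
    move=> z z' e; congr (G _ * f _); apply: eq_restr => s sN; apply: e;
      by rewrite in_setC negbK in_setU sN ?orbT.
  move=> z t; rewrite in_setC negbK in_setU => tNK n0; rewrite /frozen_kernel /frozen.
  case/orP: tNK => tt; rewrite tt //= (_ : [forall _ in _, _]) ?orbT //.
  apply/forall_inP => u uP; apply/implyP => _; apply/eqP.
  rewrite -(@glue_restr _ _ N z x) ?(parK_ndK clK) // Gx // => G0.
  by apply: n0; rewrite G0; ring.
transitivity (Rsum (fun j : cfg (Xsub X N) * cfg (Xsub X K) =>
    (H j.1 * P1 [set j.1] setT) * P2 [set j.2] setT) +
  Rsum (fun j : cfg (Xsub X N) * cfg (Xsub X K) =>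
    (G j.1 * P1 [set j.1] setT) * (f j.2 * P2 [set j.2] setT))).
  rewrite -RsumD; apply: eq_Rsum => j; rewrite /weight; ring.
rewrite (Rsum_prod (fun k => H k * P1 [set k] setT) (fun k => P2 [set k] setT)).
rewrite (Rsum_prod (fun k => G k * P1 [set k] setT) (fun k => f k * P2 [set k] setT)).
by rewrite (fcpm_Rsum fP2 T2) Rmult_1_r.
Qed.

End Product.
End Factorisation.

(** * The two inequalities between the lower expectations *)

Theorem theorem4 (I : finType) (par : rel I) (X : I -> finType)
  (M : forall s : I, cfg X -> (X s -> R) -> Prop)
  (Hdag : acyclic par) (Hne : forall s, inhabited (X s))
  (HM : local_models par M)
  (K : {set I}) (HK : closedK par K)
  (f : cfg (Xsub X K) -> R) (x : cfg X)
  (h : cfg (Xsub X (ndK par K)) -> R)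
  (g : cfg (Xsub X (nd'K par K)) -> R) (Hg : forall w, 0 <= g w) :
  lowE par M (fun z : cfg X =>
      h (restr (ndK par K) z)
      + g (restr (nd'K par K) z)
        * indR (restr (parK par K) z == restr (parK par K) x)
        * f (restr K z))
  = lowE_sub par M (ndK par K) x (fun w =>
      h w
      + g (restr (nd'K par K) (glue w x))
        * indR (restr (parK par K) (glue w x) == restr (parK par K) x)
        * lowE_sub par M K x f).
Proof.
set N := ndK par K; set c := lowE_sub par M K x f.
have subN u : u \in parK par K -> u \in N by exact: parK_ndK.
have sub'N u : u \in nd'K par K -> u \in N by rewrite inE => /andP[].
(* Both [nd'K par K] and [parK par K] lie in [N], so [g] times the indicator is a function of the
   coordinates in [N]. *)
pose G (w : cfg (Xsub X N)) := g (restr (nd'K par K) (glue w x)) *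
  indR (restr (parK par K) (glue w x) == restr (parK par K) x).
have G0 w : 0 <= G w by apply: Rmult_le_pos; [exact: Hg | exact: indR_ge0].
have GE z : g (restr (nd'K par K) z) * indR (restr (parK par K) z == restr (parK par K) x) =
    G (restr N z).
  rewrite /G (eq_restr (K := nd'K par K) (y := z)) => [|s sN]; last first.
    by rewrite glue_restr // sub'N.
  by rewrite (eq_restr (K := parK par K) (z := glue _ _) (y := z)) // => s sP;
    rewrite glue_restr // subN.
have Gx w : G w <> 0 -> forall u, u \in parK par K -> glue w x u = x u.
  move=> Gw; apply/restr_eqP; case: eqP Gw => // ne; rewrite /G; case: eqP => // _ [].
  by rewrite /=; ring.
rewrite (_ : (fun z => _) = (fun z => h (restr N z) + G (restr N z) * f (restr K z))); last first.
  by apply: functional_extensionality => z; rewrite GE.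
have dagN := acyclic_par_sub Hdag (K := N); have HMN := local_models_sub HM (K := N) x.
have dagK := acyclic_par_sub Hdag (K := K); have HMK := local_models_sub HM (K := K) x.
have T0 : [set: cfg X] != set0 by apply/set0Pn; exists x; rewrite inE.
apply: Rle_antisym.
  apply: (le_lowE dagN HMN (restr N x)) => P1 irr1.
  have -> : expect P1 (fun w => h w + G w * c) = expect P1 h + c * expect P1 G.
    rewrite /expect mulRsum -RsumD; apply: eq_Rsum => w; ring.
  have A0 : 0 <= expect P1 G.
    apply: Rsum_ge0 => w; apply: Rmult_le_pos => //; case: irr1 => fP _.
    by apply: fcpm_ge0 => //; apply/set0Pn; exists w; rewrite inE.
  have bound P2 : irr_ext (par_sub par K) (M_sub M K x) P2 ->
      lowE par M (fun z => h (restr N z) + G (restr N z) * f (restr K z)) <=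
      expect P1 h + expect P1 G * expect P2 f.
    move=> irr2; have [P irr <-] := irr_ext_product Hdag HM HK irr1 irr2 h f Gx.
    exact: lowE_le.
  set L := lowE _ _ _ in bound *.
  (* If [f] gets weight 0, any [P2] gives the inequality. Otherwise dividing [bound] by the positive
     weight bounds every [expect P2 f] from below, hence also their infimum [c]. *)
  have [A00|A1] := Req_dec (expect P1 G) 0.
    have [P2 /bound] := irr_ext_nonempty dagK HMK (restr K x).
    by rewrite A00; lra.
  have Apos : 0 < expect P1 G by lra.
  have : (L - expect P1 h) / expect P1 G <= c.
    apply: (le_lowE dagK HMK (restr K x)) => P2 /bound bP2.
    apply: (Rmult_le_reg_r (expect P1 G)) => //.
    by rewrite /Rdiv Rmult_assoc Rinv_l //; lra.
  move/(Rmult_le_compat_r _ _ _ A0); rewrite /Rdiv Rmult_assoc Rinv_l //; lra.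
apply: (le_lowE Hdag HM x) => P irr; have [fP _] := irr.
have dN0 : [disjoint set0 & N] by rewrite -setI_eq0 set0I.
(* The marginal on [N] arises by conditioning on no coordinate; [N] contains the parents of its
   nodes. *)
have irr1 : irr_ext (par_sub par N) (M_sub M N x)
    (fun E B => P (restr N @^-1: E) (restr N @^-1: B :&: ev_eq set0 x)).
  apply: (irr_ext_restr Hdag HM) => // [|s sN|s _]; first exact: closed_ndK.
    apply/subsetP => u; rewrite in_setU inE in_set0 /= => us.
    exact: ndK_anc sN (connect1 us).
  exact: sub0set.
apply: Rle_trans (lowE_le dagN HMN (restr N x) _ irr1) _.
have ev0 : ev_eq set0 x = setT.
  by apply/setP => z; rewrite in_setT; apply/in_ev_eqP => s; rewrite inE.
rewrite /expect preimsetT setTI ev0 (sum_restr (fun w => h w + G w * c) fP T0).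
(* It remains to compare [f] with [c] under the weight [G], which the tower property does separately
   for each value of the coordinates in [N]. *)
suff : 0 <= Rsum (fun z => G (restr N z) * (f (restr K z) - c) * P [set z] setT).
  move=> gap; rewrite -[X in X <= _]Rplus_0_r.
  apply: Rle_trans (Rplus_le_compat_l _ _ _ gap) _; rewrite -RsumD.
  by apply: Req_le; apply: eq_Rsum => z; rewrite -/N; ring.
have restrN z z' : z' \in ev_eq N z -> restr N z' = restr N z.
  by move/in_ev_eqP => e; exact: eq_restr.
rewrite (fcpm_tower (S := N)) // => [|z z' _|z z' /restrN -> //]; last by rewrite !inE.
apply: Rsum_ge0 => z.
(* Only a [z] with nonzero [G] matters. It agrees with [x] on [parK par K], so the law on [K] given
   its coordinates in [N] is in the extension for [x] and gives [f] an expectation of at least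
   [c]. *)
have [->|Gz] := Req_dec (G (restr N z)) 0; first by rewrite !Rmult_0_l; lra.
apply: Rmult_le_pos; first by apply: Rmult_le_pos => //; exact: fcpm_ge0.
have irr2 : irr_ext (par_sub par K) (M_sub M K x)
    (fun E B => P (restr K @^-1: E) (restr K @^-1: B :&: ev_eq N z)).
  apply: (irr_ext_sub_dep HM (x := z)) => [u uP|].
    by rewrite -(Gx _ Gz u uP) glue_restr // subN.
  apply: (irr_ext_restr Hdag HM) => //; first exact: ndK_disjoint.
    by move=> s; exact: par_ndKU.
  exact: ndK_nondesc.
have := lowE_le dagK HMK (restr K x) f irr2.
rewrite /expect preimsetT setTI (sum_restr f fP (ev_eq_neq0 N z)) -/(lowE_sub par M K x f) -/c => cle.
rewrite (_ : Rsum _ = Rsum (fun z' => f (restr K z') * P [set z'] (ev_eq N z)) +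
    - (c * Rsum (fun z' => P [set z'] (ev_eq N z)))).
  by rewrite (fcpm_Rsum fP (ev_eq_neq0 N z)); lra.
by rewrite mulRsum -Rsum_opp -RsumD; apply: eq_Rsum => z'; ring.
Qed.
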